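(* Let $n\ge1$ and let $\delta>0$ be fixed. Let $s\in\mathbb{R}$ and let $\mathbf b\in\mathcal H^s(\mathbf T^n)$ satisfy $\widehat{\mathbf b}_0=\mathbf 0$. Let $\mathbf u^{\mathcal N}\in\mathcal H^{s+2}(\mathbf T^n)$ be the solution of $\mathcal N\mathbf u=\mathbf b$ with $\widehat{\mathbf u}^{\mathcal N}_0=\mathbf 0$, and for $\beta<n+2$ let $\mathbf u^{\delta,\beta}\in\mathcal H^{s'}(\mathbf T^n)$, $s'=s+\max\{0,\beta-n\}$, be the solution of $\mathcal L^{\delta,\beta}\mathbf u=\mathbf b$ with $\widehat{\mathbf u}^{\delta,\beta}_0=\mathbf 0$. Then for any $0<\epsilon<2$, $$\lim_{\beta\to (n+2)^-}\mathbf u^{\delta,\beta}=\mathbf u^{\mathcal N}\quad\text{in }\mathcal H^{s_0}(\mathbf T^n),\qquad s_0=s+2-\epsilon.$$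
   Context: Torus and spaces: $\mathbf T^n=\prod_{i=1}^n[0,2\pi]$ with periodic identification; a periodic vector distribution $\mathbf g$ is written $\mathbf g=\sum_{k\in\mathbb{Z}^n}\widehat{\mathbf g}_k e^{ik\cdot x}$ with Fourier coefficients $\widehat{\mathbf g}_k\in\mathbb{C}^n$. For $q\in\mathbb{R}$, $\mathcal H^q(\mathbf T^n)$ is the space of periodic vector distributions with $\|\mathbf g\|^2_{\mathcal H^q}=\sum_k(1+\|k\|^2)^q\|\widehat{\mathbf g}_k\|^2<\infty$. Multipliers: with ${}_pF_q(a_1,\dots,a_p;b_1,\dots,b_q;x)=\sum_{m\ge0}\frac{(a_1)_m\cdots(a_p)_m}{(b_1)_m\cdots(b_q)_m}\frac{x^m}{m!}$, where $(a)_m=a(a+1)\cdots(a+m-1)$, set for $\nu\in\mathbb{R}^n$ $$\lambda_1(\nu)=-\|\nu\|^2\Big(3\mu\,{}_3F_4\big(1,\tfrac52,\tfrac{n+2-\beta}{2};2,\tfrac32,\tfrac{n+4}{2},\tfrac{n+4-\beta}{2};-\tfrac14\|\nu\|^2\delta^2\big)+(\lambda^*-\mu)\,{}_1F_2\big(\tfrac{n+2-\beta}{2};\tfrac{n+2}{2},\tfrac{n+4-\beta}{2};-\tfrac14\|\nu\|^2\delta^2\big)^2\Big),$$ $$\lambda_2(\nu)=-\mu\|\nu\|^2\,{}_2F_3\big(1,\tfrac{n+2-\beta}{2};2,\tfrac{n+4}{2},\tfrac{n+4-\beta}{2};-\tfrac14\|\nu\|^2\delta^2\big).$$ $M^{\delta,\beta}(\nu)$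 is the real symmetric $n\times n$ matrix with $M^{\delta,\beta}(\nu)\nu=\lambda_1(\nu)\nu$ and $M^{\delta,\beta}(\nu)w=\lambda_2(\nu)w$ for $w\perp\nu$; $M^{\delta,\beta}(0)=0$. Write $M_k=M^{\delta,\beta}(k)$. Operators: the linear state-based peridynamic operator acts by $\mathcal L^{\delta,\beta}\mathbf u=\sum_{k\in\mathbb{Z}^n}M_k\widehat{\mathbf u}_ke^{ik\cdot x}$. The Navier operator $\mathcal N\mathbf u=(\lambda^*+\mu)\nabla(\nabla\cdot\mathbf u)+\mu\Delta\mathbf u$ acts by $\mathcal N\mathbf u=\sum_kM^{\mathcal N}_k\widehat{\mathbf u}_ke^{ik\cdot x}$ with $M^{\mathcal N}_k=-(\lambda^*+\mu)k\otimes k-\mu\|k\|^2I$. Standing assumption: the Lamé parameters satisfy $\mu>0$, $\lambda^*+2\mu>0$ (so the Navier equation is solvable), and are such that $\lambda_1(\nu)<0$ for all $\nu\ne0$ and all parameter values under consideration (and $\lambda_2(\nu)<0$ for all $\nu\neq 0$). *)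

(* Defs.v *)
(* MathComp-Analysis, with [R[i]] from mathcomp-real-closed for the complex
   Fourier coefficients. *)
From HB Require Import structures.
From mathcomp Require Import all_boot all_order all_algebra.
From mathcomp Require Import all_classical all_reals all_analysis.
From mathcomp Require Import complex.
Set Implicit Arguments.
Unset Strict Implicit.
Unset Printing Implicit Defensive.
Import Order.TTheory GRing.Theory Num.Theory.
Import numFieldNormedType.Exports.
Local Open Scope classical_set_scope.
Local Open Scope ring_scope.

Definition dot (R : pzRingType) (n : nat) (v w : 'cV[R]_n) : R :=
  \sum_(i < n) v i 0 * w i 0.

Definition normsq (R : pzRingType) (n : nat) (v : 'cV[R]_n) : R := dot v v.

Definition cnormsq (R : realType) (n : nat) (v : 'cV[R[i]]_n) : R :=
  \sum_(i < n) (complex.Re (v i 0) ^+ 2 + complex.Im (v i 0) ^+ 2).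

Definition realvec (R : realType) (n : nat) (k : 'cV[int]_n) : 'cV[R]_n :=
  map_mx intr k.

(* A periodic distribution is identified with its family of Fourier
   coefficients, indexed by the frequencies k in Z^n.  Arbitrary families are
   allowed here: membership in a Sobolev space [Hspace q] below already forces
   the polynomial growth that characterizes the coefficients of
   distributions. *)
Definition sfourier (R : realType) (n : nat) := 'cV[int]_n -> R[i].
Definition vfourier (R : realType) (n : nat) := 'cV[int]_n -> 'cV[R[i]]_n.

(* The Sobolev norm, with value +oo outside of the Sobolev space. *)
Definition Hnormsq (R : realType) (n : nat) (q : R) (g : vfourier R n) : \bar R :=
  \esum_(k in [set: 'cV[int]_n])
    ((1 + normsq (realvec R k)) `^ q * cnormsq (g k))%:E.

Definition Hnorm (R : realType) (n : nat) (q : R) (g : vfourier R n) : \bar R :=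
  sqrte (Hnormsq q g).

Definition Hspace (R : realType) (n : nat) (q : R) : set (vfourier R n) :=
  [set g | (Hnormsq q g < +oo)%E].
Arguments Hspace {R} n q.

Definition Hcvg (R : realType) (n : nat) (q : R) (F : set_system R)
    (u : R -> vfourier R n) (l : vfourier R n) : Prop :=
  [/\ Hspace n q l,
      \forall t \near F, Hspace n q (u t) &
      Hnorm q (fun k => u t k - l k) @[t --> F] --> 0%E].

Definition poch (R : pzRingType) (a : R) (m : nat) : R :=
  \prod_(i < m) (a + i%:R).

(* The series converges for every x when [size a <= size b] and no element of
   [b] is a nonpositive integer; this holds in all uses below for
   beta < n + 2. *)
Definition pFq (R : realType) (a b : seq R) (x : R) : R :=
  limn (series (fun m : nat =>
    (\prod_(c <- a) poch c m) / (\prod_(c <- b) poch c m) * (x ^+ m / m`!%:R))).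

Section Peridynamics.
Context {R : realType} {n : nat}.
Implicit Types (mu lams delta beta : R) (nu : 'cV[R]_n).

Definition lambda1 mu lams delta beta nu : R :=
  let x := - (1 / 4) * normsq nu * delta ^+ 2 in
  - normsq nu *
    (3 * mu *
       pFq [:: 1; 5 / 2; (n%:R + 2 - beta) / 2]
           [:: 2; 3 / 2; (n%:R + 4) / 2; (n%:R + 4 - beta) / 2] x
     + (lams - mu) *
       pFq [:: (n%:R + 2 - beta) / 2]
           [:: (n%:R + 2) / 2; (n%:R + 4 - beta) / 2] x ^+ 2).

Definition lambda2 mu delta beta nu : R :=
  let x := - (1 / 4) * normsq nu * delta ^+ 2 in
  - mu * normsq nu *
    pFq [:: 1; (n%:R + 2 - beta) / 2]
        [:: 2; (n%:R + 4) / 2; (n%:R + 4 - beta) / 2] x.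

Definition is_multiplier mu lams delta beta nu (M : 'M[R]_n) : Prop :=
  [/\ M^T = M,
      M *m nu = lambda1 mu lams delta beta nu *: nu,
      (forall w : 'cV[R]_n, dot w nu = 0 ->
         M *m w = lambda2 mu delta beta nu *: w) &
      nu = 0 -> M = 0].

(* The matrix M^{delta,beta}(nu): [multiplierP] and [multiplier_unique] show
   that [is_multiplier] determines it. *)
Definition multiplier mu lams delta beta nu : 'M[R]_n :=
  xget 0 [set M | is_multiplier mu lams delta beta nu M].

Lemma normsq_eq0 nu : (normsq nu == 0) = (nu == 0).
Proof.
apply/eqP/eqP => [h|->]; last first.
  by rewrite /normsq /dot big1 // => i _; rewrite mxE mul0r.
apply/matrixP => i j; rewrite (ord1 j) mxE; apply/eqP.
have sq0 (l : 'I_n) : true -> 0 <= nu l 0 * nu l 0.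
  by rewrite -expr2 sqr_ge0.
have /eqP := @psumr_eq0P _ _ _ _ sq0 h i isT; by rewrite mulf_eq0 orbb.
Qed.

Lemma mulmx_dot (v w : 'cV[R]_n) : v^T *m w = (dot w v)%:M.
Proof.
apply/matrixP => i j; rewrite !mxE (ord1 i) (ord1 j) eqxx mulr1n /dot.
by apply: eq_bigr => l _; rewrite mxE mulrC.
Qed.

Lemma is_multiplier_explicit mu lams delta beta nu :
  is_multiplier mu lams delta beta nu
    ((lambda2 mu delta beta nu)%:M +
     ((lambda1 mu lams delta beta nu - lambda2 mu delta beta nu) / normsq nu)
       *: (nu *m nu^T)).
Proof.
split.
- by rewrite linearD /= linearZ /= trmx_mul trmxK tr_scalar_mx.
- rewrite mulmxDl mul_scalar_mx -scalemxAl -mulmxA mulmx_dot mul_mx_scalar.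
  rewrite scalerA -/(normsq nu) -scalerDl.
  have [->|nu0] := eqVneq nu 0; first by rewrite !scaler0.
  by rewrite divfK ?normsq_eq0 // addrCA subrr addr0.
- move=> w wnu; rewrite mulmxDl mul_scalar_mx -scalemxAl -mulmxA mulmx_dot wnu.
  by rewrite mul_mx_scalar scale0r scaler0 addr0.
- move=> nu0; have -> : lambda2 mu delta beta nu = 0.
    have /eqP nn0 : normsq nu == 0 by rewrite normsq_eq0 nu0.
    by rewrite /lambda2 nn0 mulr0 mul0r.
  by rewrite nu0 mul0mx scaler0 addr0 -scalemx1 scale0r.
Qed.

Lemma multiplierP mu lams delta beta nu :
  is_multiplier mu lams delta beta nu (multiplier mu lams delta beta nu).
Proof.
by apply: (@xgetPex _ 0 [set M | is_multiplier mu lams delta beta nu M]);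
  eexists; exact: is_multiplier_explicit.
Qed.

Lemma multiplier_unique mu lams delta beta nu (M : 'M[R]_n) :
  is_multiplier mu lams delta beta nu M ->
  M = multiplier mu lams delta beta nu.
Proof.
suff uniq (A B : 'M[R]_n) : is_multiplier mu lams delta beta nu A ->
    is_multiplier mu lams delta beta nu B -> A = B.
  by move=> HM; apply: uniq HM (multiplierP _ _ _ _ _).
move=> [_ A1 A2 A0] [_ B1 B2 B0].
have [nu0|nu0] := eqVneq nu 0; first by rewrite A0 // B0.
have AB (v : 'cV[R]_n) : A *m v = B *m v.
  pose c := dot v nu / normsq nu.
  have -> : v = c *: nu + (v - c *: nu) by rewrite addrC subrK.
  have orth : dot (v - c *: nu) nu = 0.
    apply/eqP; rewrite -(mulr1n (dot _ _)).
    have := mulmx_dot nu (v - c *: nu).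
    rewrite mulmxBr -scalemxAr !mulmx_dot => /matrixP/(_ 0 0).
    rewrite !mxE !eqxx !mulr1n => <-.
    by rewrite -/(normsq nu) /c divfK ?normsq_eq0 // subrr.
  by rewrite mulmxDr [RHS]mulmxDr -!scalemxAr A1 B1 (A2 _ orth) (B2 _ orth).
apply/matrixP => i j.
have := AB (delta_mx j 0); rewrite -!colE => /matrixP/(_ i 0).
by rewrite !mxE.
Qed.

(* Fourier multiplier operator u |-> sum_k M_k u_k e^{ik.x}. *)
Definition fmult (M : 'cV[int]_n -> 'M[R]_n) (u : vfourier R n) : vfourier R n :=
  fun k => map_mx (real_complex R) (M k) *m u k.

Definition peridynamic mu lams delta beta : vfourier R n -> vfourier R n :=
  fmult (fun k => multiplier mu lams delta beta (realvec R k)).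

(* Partial derivative in the direction x_j: the factor i k_j. *)
Definition fderiv (j : 'I_n) (f : sfourier R n) : sfourier R n :=
  fun k => (0 +i* (k j 0)%:~R)%C * f k.

Definition vcomp (i : 'I_n) (u : vfourier R n) : sfourier R n :=
  fun k => u k i 0.

Definition fdiv (u : vfourier R n) : sfourier R n :=
  fun k => \sum_(j < n) fderiv j (vcomp j u) k.

Definition fgrad (f : sfourier R n) : vfourier R n :=
  fun k => \col_(j < n) fderiv j f k.

Definition flaplace (u : vfourier R n) : vfourier R n :=
  fun k => \col_(i < n) \sum_(j < n) fderiv j (fderiv j (vcomp i u)) k.

Definition navier mu lams (u : vfourier R n) : vfourier R n :=
  fun k => (lams + mu)%:C%C *: fgrad (fdiv u) k + mu%:C%C *: flaplace u k.

Definition navier_multiplier mu lams (k : 'cV[int]_n) : 'M[R]_n :=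
  - ((lams + mu) *: (realvec R k *m (realvec R k)^T))
  - (mu * normsq (realvec R k))%:M.

Lemma navierE mu lams (u : vfourier R n) :
  navier mu lams u = fmult (navier_multiplier mu lams) u.
Proof.
have sqri (x y : R) : (0 +i* x)%C * (0 +i* y)%C = - (x * y)%:C%C.
  by apply/eqP; rewrite eq_complex /= !(mul0r, mulr0, addr0, sub0r, oppr0) !eqxx.
apply/funext => k; apply/matrixP => i j; rewrite (ord1 j) {j}.
rewrite /navier /fmult /navier_multiplier map_mxB map_mxN map_mxZ map_mxM /=.
rewrite map_scalar_mx /= mulmxBl mulNmx -scalemxAl -mulmxA mul_scalar_mx.
rewrite !mxE big_ord1 !mxE /fgrad /flaplace /fderiv /fdiv /vcomp.
rewrite rmorphM /= -mulrA -!mulrN; congr (_ * _ + _ * _).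
  rewrite -sumrN !mulr_sumr; apply: eq_bigr => l _.
  by rewrite !mxE mulrA sqri rmorphM /= mulNr mulrN mulrA.
rewrite mulrN /normsq /dot rmorph_sum /= mulr_suml -sumrN.
by apply: eq_bigr => l _; rewrite !mxE mulrA sqri mulNr.
Qed.

End Peridynamics.

(* Main.v *)
Require Import Defs.
From mathcomp Require Import all_boot all_order all_algebra.
From mathcomp Require Import all_classical all_reals all_analysis.
From mathcomp Require Import complex ring lra.
Import Order.TTheory GRing.Theory Num.Theory.
Import numFieldNormedType.Exports.
Local Open Scope classical_set_scope.
Local Open Scope ring_scope.

(** Put a = (n + 2 - beta) / 2, which tends to 0 from above, and
    s = |nu|^2 delta^2 / 4.  In each hypergeometric factor of the multipliers
    the parameters a and a + 1 face each other, and
    (a)_m / (a + 1)_m = a / (a + m).  So each factor is the a-average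
    integral over 0 < r < 1 of a r^(a - 1) G(r s) of a function G independent
    of beta, and all three functions G are elementary combinations of the
    Bessel-type series H_b(s) = 0F1(; b; - s) = sum_m (- s)^m / ((b)_m m!).
    As a tends to 0 the average concentrates at r = 0, where G is 1.

    The point is to make this uniform in the frequency.  The equation
    s H_b'' + b H_b' + H_b = 0 shows that H_b^2 + s H_b'^2 is nonincreasing
    for b >= 1/2 ([bessel_energy]), whence |H_b| <= 1, and, as H_(b+1) is a
    multiple of H_b', also H_(b+1)(s) = O(s^(-1/2)) ([bessel_decay]).  The
    average Phi of G satisfies (s^a Phi)' = a s^(a - 1) G; as G decays like
    s^(-1/2), the right-hand side has integral O(a) over s >= 1, and thus
      |Phi(s) - p| <= D a p,   p = max(1, s)^(- a),
    for all s >= 0 and all small a ([smooth_profile]).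

    Consequently lambda2 is its Navier value times a factor close to p, and
    lambda1 is its Navier value times a factor close to
    (3 mu p + (lams - mu) p^2) / (lams + 2 mu), which is at least a constant
    times p because 3 mu (1 - p) + (lams + 2 mu) p lies between two positive
    numbers.  As 1 - p <= a max(1, s)^theta / theta, the inverses of the
    eigenvalues differ from the Navier ones by
    O(a) (1 + |nu|^2)^(eps / 2) / |nu|^2 ([lambda1_inv_close],
    [lambda2_inv_close]).  This is exactly what the weight of the Sobolev
    space of order s + 2 - eps absorbs against that of order s, so
      |u - uN|_(s + 2 - eps) <= K a |b|_s    ([Hnormsq_solution_le]):
    the solutions converge at a linear rate in n + 2 - beta. *)

Set Implicit Arguments.
Unset Strict Implicit.
Unset Printing Implicit Defensive.

(** * Power series dominated by the exponential *)
Section PowerSeries.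
Context {R : realType}.
Implicit Types (c d : nat -> R) (K x : R).

Definition psum c x : R := limn (pseries c x).

(** Every series below satisfies such a bound.  It gives convergence on the
    whole line, survives differentiation with the same constant, and makes
    the estimates near 0 uniform in the parameters. *)
Definition exp_dominated K c : Prop := forall m, `|c m| <= K / m`!%:R.

Lemma exp_dominated_ge0 K c : exp_dominated K c -> 0 <= K.
Proof. by move=> /(_ 0%N); rewrite fact0 divr1; apply: le_trans. Qed.

Lemma exp_dominated_term K c m x :
  exp_dominated K c -> `|c m * x ^+ m| <= K * exp_coeff `|x| m.
Proof.
move=> cK; rewrite normrM normrX /exp_coeff /= mulrCA mulrC.
by rewrite ler_wpM2l ?exprn_ge0.
Qed.

Lemma exp_dominated_majorant_cvg K x :
  cvgn (series (fun m => K * exp_coeff `|x| m)).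
Proof. by apply: is_cvg_seriesZ; exact: is_cvg_series_exp_coeff. Qed.

Lemma exp_dominated_normed_cvg K c x :
  exp_dominated K c -> cvgn (series (fun m => `|c m * x ^+ m|)).
Proof.
move=> cK; have K0 := exp_dominated_ge0 cK.
apply: (series_le_cvg _ _ _ (@exp_dominated_majorant_cvg K x));
  first by move=> m.
- by move=> m; rewrite mulr_ge0// exp_coeff_ge0.
- by move=> m; exact: exp_dominated_term.
Qed.

Lemma exp_dominated_cvg K c x : exp_dominated K c -> cvgn (pseries c x).
Proof. by move=> cK; apply: normed_cvg; exact: exp_dominated_normed_cvg cK. Qed.

Lemma psum_le K c x : exp_dominated K c -> `|psum c x| <= K * expR `|x|.
Proof.
move=> cK; apply: le_trans
  (lim_series_norm (@exp_dominated_normed_cvg _ _ x cK)) _.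
have -> : K * expR `|x| = limn (series (fun m => K * exp_coeff `|x| m)).
  by rewrite -[LHS](lim_seriesZ K (@is_cvg_series_exp_coeff _ `|x|)).
apply: lim_series_le (@exp_dominated_normed_cvg _ _ x cK)
  (@exp_dominated_majorant_cvg K x) _ => m.
exact: exp_dominated_term.
Qed.

Lemma exp_dominatedS K c :
  exp_dominated K c -> exp_dominated K (fun m => c m.+1).
Proof.
move=> cK m; apply: le_trans (cK _) _.
rewrite ler_wpM2l ?(exp_dominated_ge0 cK)// lef_pV2 ?posrE ?ltr0n ?fact_gt0//.
by rewrite ler_nat factS leq_pmull.
Qed.

Lemma exp_dominated_diffs K c :
  exp_dominated K c -> exp_dominated K (pseries_diffs c).
Proof.
move=> cK m; rewrite /pseries_diffs normrM normr_nat.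
rewrite (le_trans (ler_wpM2l _ (cK _)))// factS natrM invfM.
by rewrite mulrCA mulVKf.
Qed.

Lemma psum_derive K c x :
  exp_dominated K c -> is_derive x (1 : R) (psum c) (psum (pseries_diffs c) x).
Proof.
move=> cK; have dK := exp_dominated_diffs cK;
  have ddK := exp_dominated_diffs dK.
apply: (@pseries_snd_diffs _ _ (`|x| + 1)); first exact: exp_dominated_cvg cK.
- exact: exp_dominated_cvg dK.
- exact: exp_dominated_cvg ddK.
- by rewrite [ltRHS]ger0_norm ?addr_ge0// ltrDl.
Qed.

Lemma psum_lin c d k x : cvgn (pseries c x) -> cvgn (pseries d x) ->
  psum (fun m => k * c m + d m) x = k * psum c x + psum d x.
Proof.
move=> hc hd; rewrite /psum /pseries -[k * _](lim_seriesZ k hc) -lim_seriesD//.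
  by congr (limn (series _)); apply/funext => m /=; rewrite mulrDl -mulrA.
exact: is_cvg_seriesZ.
Qed.

Lemma psumZ c k x :
  cvgn (pseries c x) -> psum (fun m => k * c m) x = k * psum c x.
Proof.
move=> hc; rewrite /psum /pseries -[RHS](lim_seriesZ k hc).
by congr (limn (series _)); apply/funext => m /=; rewrite -mulrA.
Qed.

Lemma pseriesZ_cvg c k x :
  cvgn (pseries c x) -> cvgn (pseries (fun m => k * c m) x).
Proof.
move=> hc; rewrite /pseries (_ : (fun m => _) = k *: (fun m => c m * x ^+ m)).
  exact: is_cvg_seriesZ.
by apply/funext => m /=; rewrite -mulrA.
Qed.

Lemma pseries_cvg_recl c x : cvgn (pseries (fun m => c m.+1) x) ->
  pseries c x @ \oo --> c 0%N + x * psum (fun m => c m.+1) x.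
Proof.
move=> h; rewrite -cvg_shiftS.
rewrite (_ : [sequence _]_n =
    (fun m => c 0%N + x * pseries (fun m => c m.+1) x m)).
  by apply: cvgD; [exact: cvg_cst | apply: cvgM; [exact: cvg_cst | exact: h]].
apply/funext => m; rewrite /= /pseries /series /= big_nat_recl//= expr0 mulr1.
by rewrite mulr_sumr; congr (_ + _); apply: eq_bigr => i _; rewrite exprS; ring.
Qed.

Lemma psum_recl c x : cvgn (pseries (fun m => c m.+1) x) ->
  psum c x = c 0%N + x * psum (fun m => c m.+1) x.
Proof. by move=> h; apply/cvg_lim => //; exact: pseries_cvg_recl. Qed.

Lemma pseries_euler_cvg K c x :
  exp_dominated K c -> cvgn (pseries (fun m => m%:R * c m) x).
Proof.
move=> cK; apply/cvg_ex; eexists; apply: pseries_cvg_recl.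
exact: (@exp_dominated_cvg _ _ x (exp_dominated_diffs cK)).
Qed.

(** The Euler operator x d/dx multiplies the m-th coefficient by m; this turns
    recurrences between coefficients into differential equations. *)
Lemma psum_euler K c x : exp_dominated K c ->
  x * psum (pseries_diffs c) x = psum (fun m => m%:R * c m) x.
Proof.
move=> cK; rewrite (@psum_recl (fun m => m%:R * c m)) ?mul0r ?add0r//.
exact: (@exp_dominated_cvg _ _ x (exp_dominated_diffs cK)).
Qed.

End PowerSeries.

(** * Bessel-type series: energy and decay *)
Section Bessel.
Context {R : realType}.
Implicit Types (b s x : R) (m : nat).

(** The derivative is two-sided at [a] too, which gives continuity there. *)
Lemma nonincreasing_from (f f' : R -> R) a :
  (forall x, a <= x -> is_derive x (1 : R) f (f' x)) ->
  (forall x, a <= x -> f' x <= 0) -> forall x, a <= x -> f x <= f a.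
Proof.
move=> df f'0 x ax; apply: (@ler0_derive1_nincry _ f a) => //.
- by move=> y; rewrite in_itv/= andbT => /ltW/df[].
- move=> y; rewrite in_itv/= andbT => /ltW ay.
  by rewrite derive1E (@derive_val _ _ _ _ _ _ _ (df y ay)) f'0.
- apply: derivable_within_continuous => y; rewrite in_itv/= andbT => ay.
  by have [] := df y ay.
Qed.

Lemma pochS b m : poch b m.+1 = poch b m * (b + m%:R).
Proof. by rewrite /poch big_ord_recr. Qed.

Lemma poch_recl b m : poch b m.+1 = b * poch (b + 1) m.
Proof.
rewrite /poch big_ord_recl /= addr0; congr (_ * _); apply: eq_bigr => i _.
by rewrite /bump /= add1n -natr1; ring.
Qed.

Lemma poch_gt0 b m : 0 < b -> 0 < poch b m.
Proof. by move=> b0; apply: prodr_gt0 => i _; rewrite ltr_wpDr. Qed.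

(** Only the first factor b of the product can be below 1. *)
Lemma poch_ge b m : 1 / 2 <= b -> 1 / 2 <= poch b m.
Proof.
move=> hb; elim: m => [|[|m] IH]; first by rewrite /poch big_ord0; lra.
  by move: hb; rewrite pochS /poch big_ord0 addr0 !mul1r.
rewrite pochS; apply: le_trans IH _; rewrite ler_peMr//.
  by apply/ltW/poch_gt0; lra.
by rewrite -natr1; have := ler0n R m; lra.
Qed.

(** Taylor coefficients of s |-> 0F1(; b; - s), which is, up to a constant, a
    power of s times the Bessel function J_(b-1) at 2 sqrt s. *)
Definition bessel_coef b m : R := (-1) ^+ m / (poch b m * m`!%:R).

Lemma bessel_coef0 b : bessel_coef b 0 = 1.
Proof. by rewrite /bessel_coef /poch big_ord0 fact0 expr0 mulr1 divr1. Qed.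

Lemma bessel_exp_dominated b : 1 / 2 <= b -> exp_dominated 2 (bessel_coef b).
Proof.
move=> hb m; rewrite /bessel_coef invfM mulrA normrM normfV normr_nat
  ler_wpM2r//.
rewrite normrM normrX normrN1 expr1n mul1r normfV.
have := poch_ge m hb => h; rewrite gtr0_norm ?poch_gt0//; last by lra.
by rewrite -[leRHS]invrK lef_pV2 ?posrE ?invr_gt0 ?poch_gt0//; lra.
Qed.

Lemma bessel_coefS b m : 0 < b ->
  m.+1%:R * (b + m%:R) * bessel_coef b m.+1 = - bessel_coef b m.
Proof.
move=> b0; rewrite /bessel_coef pochS factS natrM exprS.
have := poch_gt0 m b0 => p0; have bm : 0 < b + m%:R by rewrite ltr_wpDr.
have f0 : (m`!)%:R != 0 :> R by rewrite pnatr_eq0 -lt0n fact_gt0.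
have : m.+1%:R != 0 :> R by rewrite pnatr_eq0.
move: m.+1%:R => M m0; by field; rewrite m0 f0 !gt_eqF.
Qed.

Lemma bessel_coef_shift b m : 0 < b ->
  bessel_coef b m.+1 = - b^-1 * (bessel_coef (b + 1) m / m.+1%:R).
Proof.
move=> b0; rewrite /bessel_coef poch_recl factS natrM exprS.
have b10 : 0 < b + 1 by lra.
have := poch_gt0 m b10 => p0.
have f0 : (m`!)%:R != 0 :> R by rewrite pnatr_eq0 -lt0n fact_gt0.
have : m.+1%:R != 0 :> R by rewrite pnatr_eq0.
move: m.+1%:R => M m0; by field; rewrite m0 f0 !gt_eqF.
Qed.

(** Hence the derivative of 0F1(; b; - s) is - 0F1(; b + 1; - s) / b. *)
Lemma bessel_diffs b : 0 < b ->
  pseries_diffs (bessel_coef b) = (fun m => - b^-1 * bessel_coef (b + 1) m).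
Proof.
move=> b0; apply/funext => m; rewrite /pseries_diffs bessel_coef_shift//.
have : m.+1%:R != 0 :> R by rewrite pnatr_eq0.
move: m.+1%:R => M m0; by field; rewrite m0 gt_eqF.
Qed.

Lemma bessel_ode b s : 1 / 2 <= b ->
  s * psum (pseries_diffs (pseries_diffs (bessel_coef b))) s +
  b * psum (pseries_diffs (bessel_coef b)) s + psum (bessel_coef b) s = 0.
Proof.
move=> hb; have b0 : 0 < b by lra.
have cK := bessel_exp_dominated hb; have dK := exp_dominated_diffs cK.
rewrite (psum_euler s dK) [X in X + _]addrC.
rewrite -(psum_lin b (@exp_dominated_cvg _ _ _ s dK)
  (@pseries_euler_cvg _ _ _ s dK)).
rewrite (_ : (fun m => _) = (fun m => -1 * bessel_coef b m)); last first.
  apply/funext => m; rewrite mulN1r -bessel_coefS// /pseries_diffs; ring.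
by rewrite (psumZ _ (@exp_dominated_cvg _ _ _ s cK)) mulN1r addNr.
Qed.

(** By the differential equation, H^2 + s H'^2 has derivative
    (1 - 2 b) H'^2 <= 0, and it is 1 at s = 0. *)
Lemma bessel_energy b s : 1 / 2 <= b -> 0 <= s ->
  psum (bessel_coef b) s ^+ 2 + s * psum (pseries_diffs (bessel_coef b)) s ^+ 2
    <= 1.
Proof.
move=> hb s0; have b0 : 0 < b by lra.
have cK := bessel_exp_dominated hb; have dK := exp_dominated_diffs cK.
pose H := psum (bessel_coef b); pose H' := psum (pseries_diffs (bessel_coef b)).
pose H2 := psum (pseries_diffs (pseries_diffs (bessel_coef b))).
pose E (x : R) := H x ^+ 2 + x * H' x ^+ 2.
have E0 : E 0 = 1.
  rewrite /E mul0r addr0 /H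
    (psum_recl (@exp_dominated_cvg _ _ _ 0 (exp_dominatedS cK))) bessel_coef0.
  by rewrite mul0r addr0 expr1n.
rewrite -[leRHS]E0.
apply: (@nonincreasing_from E (fun x => (1 - 2 * b) * H' x ^+ 2)) => // x x0.
  have dH := psum_derive x cK; have dH' := psum_derive x dK.
  apply: is_derive_eq.
  rewrite /= -/H -/H' -/H2.
  have := bessel_ode x hb; rewrite -/(H x) -/(H' x) -/(H2 x) => ode.
  have {}ode : x * H2 x = - b * H' x - H x by lra.
  transitivity (2 * H x * H' x + H' x ^+ 2 + 2 * H' x * (x * H2 x)).
    rewrite /GRing.scale /=; ring.
  by rewrite ode; ring.
by rewrite mulr_le0_ge0 ?sqr_ge0//; lra.
Qed.

Lemma bessel_le1 b s : 1 / 2 <= b -> 0 <= s -> `|psum (bessel_coef b) s| <= 1.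
Proof.
move=> hb s0; have h := bessel_energy hb s0.
rewrite -(ler_pXn2r (n := 2)) ?nnegrE// expr1n real_normK ?num_real//.
have : 0 <= s * psum (pseries_diffs (bessel_coef b)) s ^+ 2.
  by rewrite mulr_ge0 ?sqr_ge0.
lra.
Qed.

(** The energy bound reads s H_b'^2 <= 1, and H_b' = - H_(b+1) / b.  The rate is
    not optimal, but any negative power of s suffices for averaging. *)
Lemma bessel_decay b s : 1 / 2 <= b -> 1 <= s ->
  `|psum (bessel_coef (b + 1)) s| <= b * s `^ (- 2^-1).
Proof.
move=> hb s1; have s0 : 0 <= s by lra.
have b0 : 0 < b by lra.
have b1 : 1 / 2 <= b + 1 by lra.
have := bessel_energy hb s0; rewrite bessel_diffs//.
rewrite (psumZ _ (@exp_dominated_cvg _ _ _ s (bessel_exp_dominated b1))).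
set H := psum (bessel_coef (b + 1)) s => h.
have {h} : s * H ^+ 2 <= b ^+ 2.
  have : s * (- b^-1 * H) ^+ 2 <= 1.
    by have := sqr_ge0 (psum (bessel_coef b) s); lra.
  have -> : s * (- b^-1 * H) ^+ 2 = s * H ^+ 2 / b ^+ 2.
    by field; rewrite gt_eqF.
  by rewrite ler_pdivrMr ?exprn_gt0// mul1r.
rewrite powRN powR12_sqrt// => h.
have q0 : 0 < Num.sqrt s by rewrite sqrtr_gt0; lra.
have [b0' q0'] := (ltW b0, ltW q0).
rewrite ler_pdivlMr// -(ler_pXn2r (n := 2)) ?nnegrE ?mulr_ge0//.
by rewrite exprMn sqr_sqrtr// real_normK ?num_real// mulrC.
Qed.

Lemma bessel_mean_exp_dominated b : 1 / 2 <= b ->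
  exp_dominated 2 (fun m => bessel_coef b m / m.+1%:R).
Proof.
move=> hb m; rewrite normrM normfV normr_nat.
apply: le_trans (bessel_exp_dominated hb m); rewrite ler_piMr//.
by rewrite invf_le1// ler1n.
Qed.

(** Dividing the m-th coefficient by m + 1 amounts to taking the mean of the
    function over [0, s]; as H_(b+1) = - b H_b', this mean is
    b (1 - H_b(s)) / s, and H_b is bounded. *)
Lemma bessel_mean_decay b s : 1 / 2 <= b -> 1 <= s ->
  `|psum (fun m => bessel_coef (b + 1) m / m.+1%:R) s| <= 2 * b * s `^ (- 2^-1).
Proof.
move=> hb s1; have s0 : 0 < s by lra.
have b0 : 0 < b by lra.
have b1 : 1 / 2 <= b + 1 by lra.
have := psum_recl
  (@exp_dominated_cvg _ _ _ s (exp_dominatedS (bessel_exp_dominated hb))).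
under [X in s * psum X s]eq_fun do rewrite bessel_coef_shift//.
rewrite (psumZ _ (@exp_dominated_cvg _ _ _ s (bessel_mean_exp_dominated b1)))
  bessel_coef0.
set G := psum (fun m => bessel_coef (b + 1) m / m.+1%:R) s => h.
have {h} -> : G = b * (1 - psum (bessel_coef b) s) / s.
  by rewrite h; field; rewrite !gt_eqF.
have := bessel_le1 hb (ltW s0); move: (psum _ s) => H;
  rewrite ler_norml => /andP[h1 h2].
rewrite !normrM normfV (gtr0_norm s0) (gtr0_norm b0) (mulrC 2).
have [b0' s0'] := (ltW b0, ltW s0).
apply: ler_pM; rewrite ?mulr_ge0 ?invr_ge0//.
  by rewrite ler_wpM2l// ger0_norm; lra.
rewrite powRN lef_pV2 ?posrE ?powR_gt0//.
by apply: le_trans (ler1_powR s1 _) _ => //; rewrite invf_le1//; lra.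
Qed.

End Bessel.

(** * Averaging against a r^(a - 1) *)
Section Smoothing.
Context {R : realType}.
Implicit Types (a s W theta : R) (g : nat -> R).

(** Coefficients of the average over 0 < r < 1 of a r^(a - 1) G(r s), where G
    has coefficients [g]. *)
Definition smooth a g : nat -> R := fun m => a / (a + m%:R) * g m.

(** The common size of the averages, when G decays: for s <= 1 the average is
    close to G(0) = 1, while for large s only the mass s^(- a) that
    a r^(a - 1) gives to r < 1 / s contributes to first order. *)
Definition profile a s : R := Num.max 1 s `^ (- a).

Lemma profile_gt0 a s : 0 < profile a s.
Proof. by rewrite powR_gt0// lt_max ltr01. Qed.

Lemma profile_le1 a s : 0 <= a -> profile a s <= 1.
Proof.
move=> a0; rewrite /profile powRN invf_le1; last first.
  by rewrite powR_gt0// lt_max ltr01.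
rewrite -[leLHS](powRr0 (Num.max 1 s)); apply: ler_powR => //.
by rewrite le_max lexx.
Qed.

(** 1 - exp (- a ln W) <= a ln W and theta ln W <= W^theta: an arbitrarily
    small power of the frequency buys a factor a. *)
Lemma onem_profile_le a s theta : 0 <= a -> 0 < theta ->
  1 - profile a s <= a / theta * Num.max 1 s `^ theta.
Proof.
move=> a0 th0; set W := Num.max 1 s.
have W1 : 1 <= W by rewrite le_max lexx.
have W0 : 0 < W by lra.
rewrite /profile /powR gt_eqF//= -/W.
have h1 := expR_ge1Dx (- a * ln W); have h2 := expR_ge1Dx (theta * ln W).
rewrite mulrAC ler_pdivlMr//.
apply: (@le_trans _ _ (a * (theta * ln W))).
  by rewrite mulrCA mulrC ler_wpM2l ?(ltW th0)//; lra.
by rewrite ler_wpM2l//; lra.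
Qed.

Lemma smooth_exp_dominated K g a : 0 < a -> exp_dominated K g ->
  exp_dominated K (smooth a g).
Proof.
move=> a0 gK m; rewrite /smooth normrM.
apply: le_trans (gK m); rewrite ler_piMl//.
have am : 0 < a + m%:R by rewrite ltr_wpDr.
rewrite ger0_norm ?divr_ge0 ?(ltW a0) ?(ltW am)// ler_pdivrMr// mul1r.
by rewrite lerDl.
Qed.

(** All the coefficients of the average but the first carry a factor a. *)
Lemma smooth_near0 K g a s : 0 < a -> exp_dominated K g -> g 0%N = 1 ->
  0 <= s <= 1 -> `|psum (smooth a g) s - 1| <= K * expR 1 * a.
Proof.
move=> a0 gK g0 /andP[s0 s1]; have K0 := exp_dominated_ge0 gK.
have tK : exp_dominated (a * K) (fun m => smooth a g m.+1).
  move=> m; rewrite /smooth normrM -mulrA.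
  apply: ler_pM => //; last exact: exp_dominatedS.
  have am : 0 < a + m.+1%:R by rewrite ltr_wpDr.
  rewrite ger0_norm ?divr_ge0 ?(ltW a0) ?(ltW am)// ler_pdivrMr//.
  by rewrite ler_peMr ?(ltW a0)// -natr1; have := ler0n R m; lra.
have := psum_recl (@exp_dominated_cvg _ _ _ s tK).
rewrite {2}/smooth addr0 divff ?gt_eqF// mul1r g0 => ->.
rewrite addrAC subrr add0r normrM (ger0_norm s0).
have h := psum_le s tK; rewrite (ger0_norm s0) in h.
rewrite (_ : K * expR 1 * a = 1 * (a * K * expR 1)); last by ring.
apply: ler_pM => //; apply: le_trans h _.
by rewrite ler_wpM2l ?mulr_ge0 ?(ltW a0)// ler_expR.
Qed.

(** Coefficientwise, (m + a) (a / (a + m)) = a. *)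
Lemma smooth_ode K g a s : 0 < a -> exp_dominated K g ->
  s * psum (pseries_diffs (smooth a g)) s + a * psum (smooth a g) s =
  a * psum g s.
Proof.
move=> a0 gK; have sK := smooth_exp_dominated a0 gK.
rewrite (psum_euler s sK) addrC.
rewrite -(psum_lin a (@exp_dominated_cvg _ _ _ s sK)
  (@pseries_euler_cvg _ _ _ s sK)).
rewrite -(psumZ a (@exp_dominated_cvg _ _ _ s gK)); congr (psum _ s).
apply/funext => m; rewrite -mulrDl /smooth.
have am : 0 < a + m%:R by rewrite ltr_wpDr.
by field; rewrite gt_eqF.
Qed.

(** The equation of [smooth_ode] multiplied by its integrating factor. *)
Lemma smooth_scaled_derive K g a s : 0 < a -> exp_dominated K g -> 1 <= s ->
  is_derive s (1 : R) (fun x => x `^ a * psum (smooth a g) x)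
    (a * s `^ (a - 1) * psum g s).
Proof.
move=> a0 gK s1; have s0 : 0 < s by lra.
have dP := psum_derive s (smooth_exp_dominated a0 gK).
have dW := is_derive1_powR a s0.
apply: is_derive_eq; rewrite /GRing.scale /=.
have := smooth_ode s a0 gK.
have -> : s `^ a = s * s `^ (a - 1).
  by rewrite -{2}(powRr1 (ltW s0)) -powRD ?(gt_eqF s0) ?implybT// addrCA subrr
    addr0.
move: (psum (pseries_diffs _) s) (psum (smooth a g) s) (psum g s) => D P G h.
by rewrite -[RHS]mulrA [RHS]mulrCA -h; ring.
Qed.

(** The derivative of s^a Phi is at most C a s^(-5/4) in absolute value, for
    a <= 1/4.  Adding 4 C a s^(-1/4), whose derivative is - C a s^(-5/4), to
    either sign of s^a Phi gives a nonincreasing function. *)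
Lemma smooth_tail K g C a s : 0 < a <= 1 / 4 -> exp_dominated K g ->
  (forall x, 1 <= x -> `|psum g x| <= C * x `^ (- 2^-1)) ->
  1 <= s -> `|s `^ a * psum (smooth a g) s - psum (smooth a g) 1| <= 4 * C * a.
Proof.
move=> /andP[a0 a4] gK gC s1.
have C0 : 0 <= C by have := gC 1 (lexx _); rewrite powR1 mulr1; apply: le_trans.
pose f (e x : R) :=
  e * (x `^ a * psum (smooth a g) x) + 4 * C * a * x `^ (- 4^-1).
have key e : `|e| <= 1 -> f e s <= f e 1.
  move=> e1; apply: (@nonincreasing_from _ (f e) (fun x =>
    e * (a * x `^ (a - 1) * psum g x) - C * a * x `^ (- 4^-1 - 1))) => // x x1.
    have x0 : 0 < x by lra.
    have dP := smooth_scaled_derive a0 gK x1.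
    have dW := is_derive1_powR (- 4^-1) x0.
    by apply: is_derive_eq; rewrite /GRing.scale /=; field.
  have x0 : 0 < x by lra.
  rewrite subr_le0; apply: le_trans (ler_norm _) _.
  rewrite !normrM (gtr0_norm a0) (ger0_norm (powR_ge0 _ _)).
  apply: le_trans (_ : 1 * (a * x `^ (a - 1) * (C * x `^ (- 2^-1))) <= _).
    by rewrite ler_pM ?mulr_ge0 ?powR_ge0 ?(ltW a0)// ler_wpM2l ?mulr_ge0
      ?powR_ge0 ?(ltW a0)// gC.
  have -> : 1 * (a * x `^ (a - 1) * (C * x `^ (- 2^-1))) =
            C * a * (x `^ (a - 1) * x `^ (- 2^-1)) by ring.
  rewrite ler_wpM2l ?mulr_ge0 ?(ltW a0)// -powRD ?(gt_eqF x0) ?implybT//.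
  by apply: ler_powR => //; lra.
have q0 : 0 <= 4 * C * a * s `^ (- 4^-1).
  by rewrite !mulr_ge0 ?powR_ge0 ?(ltW a0).
have := key 1; have := key (-1).
rewrite /f normrN1 normr1 => /(_ (lexx _)) h1 /(_ (lexx _)) h2.
rewrite !powR1 !mul1r !mulr1 in h1 h2.
by rewrite ler_norml; apply/andP; split; lra.
Qed.

(** Up to s = 1 this is [smooth_near0]; beyond, [smooth_tail] compares
    s^a Phi(s) with Phi(1).  The error is relative to the profile, which is
    what makes the inversion of the eigenvalues possible at high frequency. *)
Lemma smooth_profile K g C : exp_dominated K g -> g 0%N = 1 ->
  (forall x, 1 <= x -> `|psum g x| <= C * x `^ (- 2^-1)) ->
  exists2 D : R, 0 <= D & forall a s, 0 < a <= 1 / 4 -> 0 <= s ->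
    `|psum (smooth a g) s - profile a s| <= D * a * profile a s.
Proof.
move=> gK g0 gC; have K0 := exp_dominated_ge0 gK.
have C0 : 0 <= C by have := gC 1 (lexx _); rewrite powR1 mulr1; apply: le_trans.
exists (K * expR 1 + 4 * C); first by rewrite addr_ge0 ?mulr_ge0 ?expR_ge0.
move=> a s /[dup] a14 /andP[a0 a4] s0; have a0' := ltW a0.
have D0 : 0 <= 4 * C * a by rewrite !mulr_ge0.
rewrite /profile; have [s1|s1] := leP s 1.
  rewrite powR1 mulr1; apply: le_trans (smooth_near0 a0 gK g0 _) _.
    by rewrite s0 s1.
  by lra.
have hs := smooth_tail a14 gK gC (ltW s1).
have h1 : `|psum (smooth a g) 1 - 1| <= K * expR 1 * a.
  by apply: smooth_near0; rewrite ?ler01 ?lexx.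
have p0 : 0 < s `^ a by rewrite powR_gt0; lra.
rewrite powRN ler_pdivlMr// -[X in _ * X](gtr0_norm p0) -normrM mulrBl mulVf
  ?gt_eqF//.
rewrite (mulrC _ (s `^ a)).
move: h1 hs; rewrite !ler_norml => /andP[? ?] /andP[? ?].
by apply/andP; split; lra.
Qed.

End Smoothing.

(** * The hypergeometric factors as averages *)
Section Hypergeometric.
Context {R : realType}.
Implicit Types (a b s : R) (m : nat).

Lemma poch_shift a m : poch (a + 1) m * a = poch a m * (a + m%:R).
Proof. by rewrite mulrC -poch_recl pochS. Qed.

Lemma poch_ratio a m : 0 < a -> poch a m / poch (a + 1) m = a / (a + m%:R).
Proof.
move=> a0; have am : 0 < a + m%:R by rewrite ltr_wpDr.
have p0 : 0 < poch (a + 1) m by apply: poch_gt0; lra.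
by apply/eqP; rewrite eqr_div ?(gt_eqF am) ?(gt_eqF p0)// -poch_shift mulrC.
Qed.

(** The hypothesis isolates the pair of parameters a, a + 1, whose quotient of
    Pochhammer symbols is the averaging factor. *)
Lemma pFq_smooth a (A B : seq R) (g : nat -> R) s : 0 < a ->
  (forall m, (\prod_(c <- A) poch c m) / (\prod_(c <- B) poch c m) *
             ((-1) ^+ m / m`!%:R) = g m * (poch a m / poch (a + 1) m)) ->
  pFq A B (- s) = psum (smooth a g) s.
Proof.
move=> a0 h; congr (limn (series _)); apply/funext => m /=.
by rewrite exprNn /smooth -poch_ratio// [_ * g m]mulrC -h; ring.
Qed.

Lemma pFq_mean (a b s : R) : 0 < a -> 0 < b ->
  pFq [:: 1; a] [:: 2; b; a + 1] (- s) =
  psum (smooth a (fun m => bessel_coef b m / m.+1%:R)) s.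
Proof.
move=> a0 b0; apply: pFq_smooth => // m; rewrite !big_cons !big_nil
  /bessel_coef.
have p2 : poch 2 m = m.+1%:R * poch 1 m :> R.
  by have := poch_shift 1 m; rewrite mulr1 -[1 + 1]/(2%:R) mulrC nat1r.
have p0 : 0 < poch 1 m :> R by apply: poch_gt0.
have q0 : 0 < poch (a + 1) m by apply: poch_gt0; lra.
have r0 : 0 < poch b m by apply: poch_gt0.
have f0 : (m`!)%:R != 0 :> R by rewrite pnatr_eq0 -lt0n fact_gt0.
have : m.+1%:R != 0 :> R by rewrite pnatr_eq0.
rewrite p2; move: m.+1%:R => M m0; by field; rewrite m0 f0 !gt_eqF.
Qed.

(** Here (5/2)_m (1)_m / ((3/2)_m (2)_m) = (1 + 2 m / 3) / (m + 1), and this is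
    2/3 + (1/3) / (m + 1). *)
Lemma pFq_mix (a b s : R) : 0 < a -> 0 < b ->
  pFq [:: 1; 5 / 2; a] [:: 2; 3 / 2; b; a + 1] (- s) =
  psum (smooth a (fun m =>
    2 / 3 * bessel_coef b m + 1 / 3 * (bessel_coef b m / m.+1%:R))) s.
Proof.
move=> a0 b0; apply: pFq_smooth => // m; rewrite !big_cons !big_nil
  /bessel_coef.
have p2 : poch 2 m = m.+1%:R * poch 1 m :> R.
  by have := poch_shift 1 m; rewrite mulr1 -[1 + 1]/(2%:R) mulrC nat1r.
have p5 : poch (5 / 2) m = poch (3 / 2) m * (1 + 2 / 3 * m%:R) :> R.
  have := poch_shift (3 / 2) m; have -> : 3 / 2 + 1 = 5 / 2 :> R by field.
  by lra.
have p0 : 0 < poch 1 m :> R by apply: poch_gt0.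
have p3 : 0 < poch (3 / 2) m :> R by apply: poch_gt0; lra.
have q0 : 0 < poch (a + 1) m by apply: poch_gt0; lra.
have r0 : 0 < poch b m by apply: poch_gt0.
have f0 : (m`!)%:R != 0 :> R by rewrite pnatr_eq0 -lt0n fact_gt0.
have : m.+1%:R != 0 :> R by rewrite pnatr_eq0.
rewrite p2 p5; have -> : m%:R = m.+1%:R - 1 :> R by rewrite -natr1 addrK.
move: m.+1%:R => M m0; by field; rewrite m0 f0 !gt_eqF.
Qed.

Lemma pFq_bessel (a b s : R) : 0 < a -> 0 < b ->
  pFq [:: a] [:: b; a + 1] (- s) = psum (smooth a (bessel_coef b)) s.
Proof.
move=> a0 b0; apply: pFq_smooth => // m; rewrite !big_cons !big_nil
  /bessel_coef.
have q0 : 0 < poch (a + 1) m by apply: poch_gt0; lra.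
have r0 : 0 < poch b m by apply: poch_gt0.
have f0 : (m`!)%:R != 0 :> R by rewrite pnatr_eq0 -lt0n fact_gt0.
by field; rewrite f0 !gt_eqF.
Qed.

Lemma pFq_bessel_profile b : 1 / 2 <= b -> exists2 D : R, 0 <= D & forall a s,
  0 < a <= 1 / 4 -> 0 <= s ->
  `|pFq [:: a] [:: b + 1; a + 1] (- s) - profile a s| <= D * a * profile a s.
Proof.
move=> hb; have hb1 : 1 / 2 <= b + 1 by lra.
have [D D0 hD] := smooth_profile (bessel_exp_dominated hb1) (bessel_coef0 _)
  (fun x => @bessel_decay _ b x hb).
exists D => // a s /[dup] ha /andP[a0 _] s0; rewrite pFq_bessel//;
  first exact: hD.
by lra.
Qed.

Lemma pFq_mean_profile b : 1 / 2 <= b -> exists2 D : R, 0 <= D & forall a s,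
  0 < a <= 1 / 4 -> 0 <= s ->
  `|pFq [:: 1; a] [:: 2; b + 1; a + 1] (- s) - profile a s|
     <= D * a * profile a s.
Proof.
move=> hb; have hb1 : 1 / 2 <= b + 1 by lra.
have [|D D0 hD] := smooth_profile (bessel_mean_exp_dominated hb1) _
  (fun x => @bessel_mean_decay _ b x hb).
  by rewrite bessel_coef0 divr1.
exists D => // a s /[dup] ha /andP[a0 _] s0; rewrite pFq_mean//;
  first exact: hD.
by lra.
Qed.

Lemma ler_norm_lin (k l x y M N : R) : 0 <= k -> 0 <= l ->
  `|x| <= M -> `|y| <= N -> `|k * x + l * y| <= k * M + l * N.
Proof.
move=> k0 l0 xM yN; apply: le_trans (ler_normD _ _) _.
by rewrite !normrM (ger0_norm k0) (ger0_norm l0) lerD// ler_wpM2l.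
Qed.

Lemma pFq_mix_profile b : 1 / 2 <= b -> exists2 D : R, 0 <= D & forall a s,
  0 < a <= 1 / 4 -> 0 <= s ->
  `|pFq [:: 1; 5 / 2; a] [:: 2; 3 / 2; b + 1; a + 1] (- s) - profile a s|
     <= D * a * profile a s.
Proof.
move=> hb; have hb1 : 1 / 2 <= b + 1 by lra.
pose g m :=
  2 / 3 * bessel_coef (b + 1) m + 1 / 3 * (bessel_coef (b + 1) m / m.+1%:R).
have k0 : 0 <= 2 / 3 :> R by lra.
have l0 : 0 <= 1 / 3 :> R by lra.
have gK : exp_dominated 2 g.
  move=> m; have h1 := bessel_exp_dominated hb1 m;
    have h2 := bessel_mean_exp_dominated hb1 m.
  apply: le_trans (ler_norm_lin k0 l0 h1 h2) _.
  by lra.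
have [||D D0 hD] := @smooth_profile _ _ g (4 / 3 * b) gK.
- by rewrite /g bessel_coef0 divr1; lra.
- move=> x x1.
  have hc := @exp_dominated_cvg _ _ _ x (bessel_exp_dominated hb1).
  have hm := @exp_dominated_cvg _ _ _ x (bessel_mean_exp_dominated hb1).
  rewrite (psum_lin (2 / 3) hc (@pseriesZ_cvg _ _ (1 / 3) _ hm)) (psumZ _ hm).
  apply: le_trans
    (ler_norm_lin k0 l0 (bessel_decay hb x1) (bessel_mean_decay hb x1)) _.
  by lra.
exists D => // a s /[dup] ha /andP[a0 _] s0; rewrite pFq_mix//; first exact: hD.
by lra.
Qed.

End Hypergeometric.

(** * Uniform comparison of the eigenvalues with the Navier ones *)
Section Eigenvalues.
Context {R : realType} {n : nat}.
Implicit Types (a s theta : R) (nu : 'cV[R]_n).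

Lemma normsq_ge0 nu : 0 <= normsq nu.
Proof. by apply: sumr_ge0 => i _; rewrite -expr2 sqr_ge0. Qed.

Lemma normsq_gt0 nu : nu != 0 -> 0 < normsq nu.
Proof. by move=> nu0; rewrite lt_neqAle eq_sym normsq_eq0 nu0 normsq_ge0. Qed.

(** |1 / P - 1| = |1 - P| / P, and dividing by the lower bound c p of P costs
    max(1, s)^a <= max(1, s)^theta; the other power theta comes from
    [onem_profile_le]. *)
Lemma inv_factor_close (c D theta : R) : 0 < c -> 0 <= D -> 0 < theta ->
  exists2 E : R, 0 <= E & forall a s P, 0 < a <= theta ->
    c * profile a s <= P -> `|P - 1| <= D * (a + (1 - profile a s)) ->
    `|P^-1 - 1| <= E * a * Num.max 1 s `^ (2 * theta).
Proof.
move=> c0 D0 th0; exists (D * (1 + theta^-1) / c).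
  by rewrite divr_ge0 ?mulr_ge0 ?addr_ge0 ?invr_ge0 ?(ltW th0) ?(ltW c0).
move=> a s P /andP[a0 ath]; have := onem_profile_le s (ltW a0) th0.
have p0 := profile_gt0 a s; have := profile_le1 s (ltW a0).
set W := Num.max 1 s; set p := profile a s => p1 hp hP hP1.
have W1 : 1 <= W by rewrite le_max lexx.
have V1 : 1 <= W `^ theta.
  by rewrite -[leLHS](powRr0 W); apply: ler_powR => //; exact: ltW.
have cp0 : 0 < c * p by rewrite mulr_gt0.
have P0 : 0 < P by apply: lt_le_trans hP.
have -> : P^-1 - 1 = (1 - P) / P by field; rewrite gt_eqF.
rewrite normrM normfV (gtr0_norm P0) distrC.
apply: (@le_trans _ _ (D * (a * (1 + theta^-1) * W `^ theta) / (c * p))).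
  apply: ler_pM => //; first by rewrite invr_ge0 ltW.
    apply: le_trans hP1 _; rewrite ler_wpM2l//.
    have aV : a <= a * W `^ theta by rewrite ler_peMr// ltW.
    by move: hp; rewrite -mulrA; lra.
  by rewrite lef_pV2.
have -> : W `^ (2 * theta) = W `^ theta * W `^ theta.
  by rewrite mulr_natl mulr2n powRD// gt_eqF ?implybT//; lra.
rewrite invfM {1}/p /profile powRN invrK.
have -> : D * (1 + theta^-1) / c * a * (W `^ theta * W `^ theta) =
  D * (a * (1 + theta^-1) * W `^ theta) * (c^-1 * W `^ theta) by ring.
rewrite !ler_wpM2l ?mulr_ge0 ?addr_ge0 ?invr_ge0 ?powR_ge0 ?(ltW a0) ?(ltW c0)
  ?(ltW th0)//.
by apply: ler_powR.
Qed.

(** Trades s = |nu|^2 delta^2 / 4 for the Sobolev weight 1 + |nu|^2. *)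
Lemma max_powR_le (delta theta : R) nu : 0 <= theta ->
  Num.max 1 (1 / 4 * normsq nu * delta ^+ 2) `^ theta <=
  Num.max 1 (1 / 4 * delta ^+ 2) `^ theta * (1 + normsq nu) `^ theta.
Proof.
move=> th0; have N0 := normsq_ge0 nu.
have d0 : 0 <= delta ^+ 2 by rewrite sqr_ge0.
set K := Num.max 1 (1 / 4 * delta ^+ 2).
have K1 : 1 <= K by rewrite le_max lexx.
have Kd : 1 / 4 * delta ^+ 2 <= K by rewrite le_max lexx orbT.
rewrite -powRM; [|by lra..].
apply: ge0_ler_powR => //; rewrite ?nnegrE ?le_max ?ler01//.
  by rewrite mulr_ge0; lra.
rewrite ge_max; apply/andP; split; first by rewrite mulr_ege1//; lra.
rewrite mulrAC; apply: ler_pM => //; first by lra.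
by lra.
Qed.

(** [lN * normsq nu] is the Navier eigenvalue, and [P] the factor by which the
    peridynamic eigenvalue deviates from it. *)
Lemma inv_eigen_close (delta theta lN E a P : R) nu :
  0 < theta -> nu != 0 -> 0 <= E -> 0 < a ->
  `|P^-1 - 1| <= E * a * Num.max 1 (1 / 4 * normsq nu * delta ^+ 2) `^ theta ->
  `|(lN * normsq nu * P)^-1 - (lN * normsq nu)^-1| <=
    `|lN|^-1 * E * Num.max 1 (1 / 4 * delta ^+ 2) `^ theta * a *
    ((1 + normsq nu) `^ theta / normsq nu).
Proof.
move=> th0 nu0 E0 a0 hP; have N0 := normsq_gt0 nu0.
have -> : (lN * normsq nu * P)^-1 - (lN * normsq nu)^-1 =
    lN^-1 * (normsq nu)^-1 * (P^-1 - 1) by rewrite !invfM mulrBr mulr1.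
rewrite !normrM !normfV (gtr0_norm N0).
apply: le_trans (_ : `|lN|^-1 / normsq nu * (E * a *
  (Num.max 1 (1 / 4 * delta ^+ 2) `^ theta * (1 + normsq nu) `^ theta)) <= _).
  rewrite ler_wpM2l ?mulr_ge0 ?invr_ge0 ?(ltW N0)//.
  apply: le_trans hP _; rewrite ler_wpM2l ?mulr_ge0 ?(ltW a0)//.
  exact: max_powR_le (ltW th0).
by rewrite le_eqVlt; apply/orP; left; apply/eqP; ring.
Qed.

Lemma lambda2_inv_close (mu delta theta : R) : (1 <= n)%N ->
  0 < mu -> 0 < theta ->
  exists E a0 : R, [/\ 0 <= E, 0 < a0 & forall (beta : R) nu,
    0 < (n%:R + 2 - beta) / 2 <= a0 -> nu != 0 ->
    `|(lambda2 mu delta beta nu)^-1 - (- mu * normsq nu)^-1| <=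
      E * ((n%:R + 2 - beta) / 2) *
      ((1 + normsq nu) `^ (2 * theta) / normsq nu)].
Proof.
move=> n1 mu0 th0; have hn : 1 <= n%:R :> R by rewrite ler1n.
have [|D D0 hD] := @pFq_mean_profile R ((n%:R + 2) / 2); first by lra.
have c0 : 0 < 1 / 2 :> R by lra.
have D1 : 0 <= D + 1 by lra.
have [E E0 hE] := inv_factor_close c0 D1 th0.
exists (`|- mu|^-1 * E * Num.max 1 (1 / 4 * delta ^+ 2) `^ (2 * theta)).
have Dp : 0 < 2 * (D + 1) by lra.
(* The last bound on a gives D a <= 1/2, so that P >= p / 2. *)
exists (Num.min (Num.min theta (1 / 4)) (2 * (D + 1))^-1); split.
- by rewrite !mulr_ge0 ?powR_ge0.
- by rewrite !lt_min th0 invr_gt0 Dp; lra.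
move=> beta nu; set a := (_ - beta) / 2; rewrite !le_min.
move=> /and3P[a0 /andP[ath a4] aD] nu0.
rewrite /lambda2; cbv zeta; rewrite !(mulNr (1 / 4)) (mulNr (1 / 4 * _)).
have -> : (n%:R + 4) / 2 = (n%:R + 2) / 2 + 1 :> R by field.
have -> : (n%:R + 4 - beta) / 2 = a + 1 :> R by rewrite /a; field.
rewrite -/a; apply: inv_eigen_close => //; rewrite ?mulr_gt0//.
set s := 1 / 4 * _ * _.
have s0 : 0 <= s.
  by apply: mulr_ge0 (sqr_ge0 _); apply: mulr_ge0 (normsq_ge0 _); lra.
have a14 : 0 < a <= 1 / 4 by rewrite a0.
have := hD a s a14 s0; set P := pFq _ _ _ => hP.
have p0 := profile_gt0 a s; have p1 := profile_le1 s (ltW a0).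
have Da : D * a <= 1 / 2.
  by move: aD; rewrite -[X in _ <= X]mul1r ler_pdivlMr//; lra.
have hP' : D * a * profile a s <= 1 / 2 * profile a s.
  by rewrite ler_wpM2r ?(ltW p0).
have Da0 : 0 <= D * a by rewrite mulr_ge0// ltW.
have hP2 : D * a * profile a s <= D * a := ler_piMr Da0 p1.
have Dq : 0 <= D * (1 - profile a s) by rewrite mulr_ge0//; lra.
move: hP; rewrite ler_norml => /andP[h1 h2].
apply: hE; first by rewrite a0.
  by lra.
by rewrite ler_norml; apply/andP; split; lra.
Qed.

(** The factor 3 is from |G + p| <= 2 p + |G - p| <= 3 p. *)
Lemma sqr_profile_close (D a p G : R) : 0 <= D -> 0 < a -> D * a <= 1 ->
  0 < p <= 1 -> `|G - p| <= D * a * p -> `|G ^+ 2 - p ^+ 2| <= 3 * (D * a * p).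
Proof.
move=> D0 a0 Da /andP[p0 p1] hG.
have Dap : 0 <= D * a * p by rewrite !mulr_ge0 ?(ltW a0) ?(ltW p0).
have Dp : D * a * p <= p by rewrite ler_piMl ?(ltW p0).
rewrite subr_sqr normrM mulrC; apply: ler_pM => //.
by move: hG; rewrite !ler_norml => /andP[? ?]; apply/andP; split; lra.
Qed.

(** With F and G exactly p, the numerator is
    3 mu p + (lams - mu) p^2 = (3 mu (1 - p) + (lams + 2 mu) p) p, at least
    min(3 mu, lams + 2 mu) p even when lams < mu; it is lams + 2 mu at p = 1.
    The actual F and G perturb it by O(a p), which is absorbed for small a. *)
Lemma lambda1_factor_close (mu lams : R) : 0 < mu -> 0 < lams + 2 * mu ->
  forall D : R, 0 <= D -> exists c D' a0 : R,
  [/\ 0 < c, 0 <= D', 0 < a0 & forall a p F G : R, 0 < a <= a0 -> 0 < p <= 1 ->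
    `|F - p| <= D * a * p -> `|G - p| <= D * a * p ->
    let P := (3 * mu * F + (lams - mu) * G ^+ 2) / (lams + 2 * mu) in
    c * p <= P /\ `|P - 1| <= D' * (a + (1 - p))].
Proof.
move=> mu0 L0 D D0; set L := lams + 2 * mu; set k := `|lams - mu|.
have k0 : 0 <= k by exact: normr_ge0.
pose c0 := Num.min (3 * mu) L.
have c00 : 0 < c0 by rewrite lt_min L0 mulr_gt0.
pose M := 3 * D * (mu + k).
have M0 : 0 <= M by rewrite /M !mulr_ge0 ?addr_ge0 ?(ltW mu0).
have D1 : 0 < D + 1 by lra.
have M1 : 0 < 2 * (M + 1) by lra.
exists (c0 / 2 / L), ((M + (3 * mu + 2 * k)) / L),
  (Num.min (D + 1)^-1 (c0 / (2 * (M + 1)))); split.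
- by rewrite !divr_gt0.
- by apply: divr_ge0 (ltW L0); lra.
- by rewrite lt_min invr_gt0 D1 divr_gt0.
move=> a p F G; rewrite le_min => /andP[a0 /andP[aD aM]] /[dup] hp /andP[p0 p1]
  hF hG /=.
have a0' := ltW a0; have p0' := ltW p0.
have Da : D * a <= 1.
  by move: aD; rewrite -[X in _ <= X]mul1r ler_pdivlMr//; lra.
have Ma : M * a <= c0 / 2.
  by move: aM; rewrite ler_pdivlMr//; lra.
have hG2 := sqr_profile_close D0 a0 Da hp hG.
set N := 3 * mu * F + _; pose N0 := 3 * mu * p + (lams - mu) * p ^+ 2.
have hN : `|N - N0| <= M * a * p.
  have -> : N - N0 = 3 * mu * (F - p) + (lams - mu) * (G ^+ 2 - p ^+ 2).
    by rewrite /N /N0; ring.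
  apply: le_trans (ler_normD _ _) _; rewrite !normrM -/k.
  rewrite (gtr0_norm mu0) normr_nat.
  have h1 := ler_wpM2l (ltW mu0) hF; have h2 := ler_wpM2l k0 hG2.
  by rewrite /M; lra.
have hN0 : c0 * p <= N0.
  have -> : N0 = (3 * mu * (1 - p) + L * p) * p by rewrite /N0 /L; ring.
  rewrite ler_wpM2r//.
  have q0 : 0 <= 1 - p by lra.
  have h1 : c0 * (1 - p) <= 3 * mu * (1 - p) by rewrite ler_wpM2r// ge_min lexx.
  have h2 : c0 * p <= L * p by rewrite ler_wpM2r// ge_min lexx orbT.
  by lra.
have hN1 : `|N0 - L| <= (3 * mu + 2 * k) * (1 - p).
  have -> : N0 - L = - ((3 * mu + (lams - mu) * (1 + p)) * (1 - p)).
    by rewrite /N0 /L; ring.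
  have q0 : 0 <= 1 - p by lra.
  rewrite normrN normrM (ger0_norm q0) ler_wpM2r//.
  apply: le_trans (ler_normD _ _) _; rewrite !normrM -/k (gtr0_norm mu0)
    normr_nat.
  rewrite lerD2l [leRHS]mulrC ler_wpM2l// ger0_norm; lra.
have hMp : M * a * p <= c0 / 2 * p := ler_wpM2r p0' Ma.
have Ma0 : 0 <= M * a by rewrite mulr_ge0.
have hMp1 : M * a * p <= M * a := ler_piMr Ma0 p1.
move: hN hN1; rewrite !ler_norml => /andP[? ?] /andP[? ?]; split.
  by rewrite mulrAC ler_pM2r ?invr_gt0//; lra.
have -> : N / L - 1 = (N - L) / L by rewrite mulrBl divff ?gt_eqF.
rewrite mulrAC !ler_pdivlMr// ?ler_pdivrMr//.
have q1 : 0 <= M * (1 - p) by rewrite mulr_ge0//; lra.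
have q2 : 0 <= (3 * mu + 2 * k) * a.
  by rewrite !mulr_ge0 ?addr_ge0 ?mulr_ge0 ?(ltW mu0).
by rewrite -!mulNr !divfK ?gt_eqF//; apply/andP; split; lra.
Qed.

Lemma lambda1_inv_close (mu lams delta theta : R) : (1 <= n)%N ->
  0 < mu -> 0 < lams + 2 * mu -> 0 < theta ->
  exists E a0 : R, [/\ 0 <= E, 0 < a0 & forall (beta : R) nu,
    0 < (n%:R + 2 - beta) / 2 <= a0 -> nu != 0 ->
    `|(lambda1 mu lams delta beta nu)^-1 -
      (- (lams + 2 * mu) * normsq nu)^-1| <=
      E * ((n%:R + 2 - beta) / 2) *
      ((1 + normsq nu) `^ (2 * theta) / normsq nu)].
Proof.
move=> n1 mu0 L0 th0; have hn : 1 <= n%:R :> R by rewrite ler1n.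
have [|D1 D10 hD1] := @pFq_mix_profile R ((n%:R + 2) / 2); first by lra.
(* The Bessel parameter of 1F2 is (n + 2) / 2 = n / 2 + 1, one less than that
   of 3F4. *)
have [|D2 D20 hD2] := @pFq_bessel_profile R (n%:R / 2); first by lra.
pose D := D1 + D2; have D0 : 0 <= D by rewrite addr_ge0.
have [c [D' [a1 [c0 D'0 a10 hP]]]] := lambda1_factor_close mu0 L0 D0.
have [E E0 hE] := inv_factor_close c0 D'0 th0.
exists (`|- (lams + 2 * mu)|^-1 * E *
  Num.max 1 (1 / 4 * delta ^+ 2) `^ (2 * theta)).
exists (Num.min (Num.min theta (1 / 4)) a1); split.
- by rewrite !mulr_ge0 ?powR_ge0.
- by rewrite !lt_min th0 a10; lra.
move=> beta nu; set a := (_ - beta) / 2; rewrite !le_min.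
move=> /and3P[a0 /andP[ath a4] aD] nu0.
rewrite /lambda1; cbv zeta; rewrite !(mulNr (1 / 4)) (mulNr (1 / 4 * _)).
have -> : (n%:R + 4) / 2 = (n%:R + 2) / 2 + 1 :> R by field.
have -> : (n%:R + 4 - beta) / 2 = a + 1 :> R by rewrite /a; field.
rewrite -/a; set s := 1 / 4 * _ * _.
have s0 : 0 <= s.
  by apply: mulr_ge0 (sqr_ge0 _); apply: mulr_ge0 (normsq_ge0 _); lra.
have a14 : 0 < a <= 1 / 4 by rewrite a0.
have := hD1 a s a14 s0; have := hD2 a s a14 s0.
have -> : n%:R / 2 + 1 = (n%:R + 2) / 2 :> R by field.
set F := pFq [:: 1; 5 / 2; a] _ _; set G := pFq [:: a] _ _ => hG hF.
have p0 := profile_gt0 a s; have p1 := profile_le1 s (ltW a0).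
have ap0 : 0 <= a * profile a s by rewrite mulr_ge0 ?(ltW a0) ?(ltW p0).
have h1 := mulr_ge0 D10 ap0; have h2 := mulr_ge0 D20 ap0.
have [||||cP hP1] := hP a (profile a s) F G.
- by rewrite a0.
- by rewrite p0.
- by apply: le_trans hF _; rewrite /D; lra.
- by apply: le_trans hG _; rewrite /D; lra.
have -> : - normsq nu * (3 * mu * F + (lams - mu) * G ^+ 2) =
    - (lams + 2 * mu) * normsq nu *
    ((3 * mu * F + (lams - mu) * G ^+ 2) / (lams + 2 * mu)).
  by field; rewrite gt_eqF.
apply: inv_eigen_close => //; rewrite ?mulr_gt0//.
by apply: hE => //; rewrite a0.
Qed.

End Eigenvalues.

(** * Operators with a longitudinal and a transverse eigenvalue *)
Section Anisotropic.
Context {R : realType} {n : nat}.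
Implicit Types (nu c x y : 'cV[R]_n) (k l : R).

(** The operator acting by [l1] along [nu] and by [l2] on its orthogonal, as in
    [is_multiplier_explicit].  For nonzero [nu] these operators are added,
    multiplied and inverted eigenvalue by eigenvalue. *)
Definition aniso l1 l2 nu : 'M[R]_n :=
  l2%:M + ((l1 - l2) / normsq nu) *: (nu *m nu^T).

Lemma aniso_scalar l nu : aniso l l nu = l%:M.
Proof. by rewrite /aniso subrr mul0r scale0r addr0. Qed.

Lemma anisoB l1 l2 k1 k2 nu :
  aniso l1 l2 nu - aniso k1 k2 nu = aniso (l1 - k1) (l2 - k2) nu.
Proof.
rewrite /aniso opprD addrACA -scalerBl -mulrBl -raddfB; congr (_ + _ *: _).
by congr (_ / _); ring.
Qed.

Lemma aniso_tr l1 l2 nu : (aniso l1 l2 nu)^T = aniso l1 l2 nu.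
Proof. by rewrite /aniso linearD linearZ /= tr_scalar_mx trmx_mul trmxK. Qed.

Lemma anisoM l1 l2 k1 k2 nu : nu != 0 ->
  aniso l1 l2 nu *m aniso k1 k2 nu = aniso (l1 * k1) (l2 * k2) nu.
Proof.
move=> nu0; have N0 : normsq nu != 0 by rewrite normsq_eq0.
have PP : (nu *m nu^T) *m (nu *m nu^T) = normsq nu *: (nu *m nu^T).
  by rewrite -mulmxA (mulmxA nu^T) mulmx_dot mul_scalar_mx -scalemxAr.
rewrite /aniso mulmxDl !mulmxDr mul_scalar_mx scale_scalar_mx mul_scalar_mx.
rewrite mul_mx_scalar -scalemxAl -scalemxAr PP !scalerA -addrA -!scalerDl.
by congr (_ + _ *: _); field.
Qed.

Lemma dot_aniso d1 d2 nu c :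
  dot (aniso d1 d2 nu *m c) c =
  d2 * normsq c + (d1 - d2) / normsq nu * dot c nu ^+ 2.
Proof.
rewrite /aniso mulmxDl mul_scalar_mx -scalemxAl -mulmxA mulmx_dot mul_mx_scalar.
rewrite scalerA /normsq {1}/dot.
under eq_bigr do rewrite !mxE mulrDl -[d2 * _ * _]mulrA -[X in _ + X]mulrA.
rewrite big_split /= -!mulr_sumr -/(dot c c); congr (_ + _).
rewrite expr2 mulrA; congr (_ * _).
by apply: eq_bigr => i _; rewrite mulrC.
Qed.

(** [aniso] is symmetric, so |A c|^2 = (A^2 c) . c. *)
Lemma normsq_aniso e1 e2 nu c : nu != 0 ->
  normsq (aniso e1 e2 nu *m c) = dot (aniso (e1 ^+ 2) (e2 ^+ 2) nu *m c) c.
Proof.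
move=> nu0; rewrite !expr2 -anisoM//.
rewrite -[LHS]mulr1n -[RHS]mulr1n.
have := mulmx_dot c (aniso e1 e2 nu *m aniso e1 e2 nu *m c).
rewrite -{1}(aniso_tr e1 e2 nu) -2!mulmxA [LHS]mulmxA -trmx_mul mulmx_dot.
by move=> /matrixP/(_ 0 0); rewrite !mxE eqxx.
Qed.

(** |A c|^2 = e2^2 (|c|^2 - t) + e1^2 t, with t the squared length of the
    component of [c] along [nu].  That t <= |c|^2 follows from the same formula
    for the orthogonal projection, [aniso 0 1]. *)
Lemma normsq_aniso_le e e1 e2 nu c : nu != 0 -> `|e1| <= e -> `|e2| <= e ->
  normsq (aniso e1 e2 nu *m c) <= e ^+ 2 * normsq c.
Proof.
move=> nu0 h1 h2; have N0 := normsq_gt0 nu0.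
have proj k1 k2 := normsq_aniso k1 k2 c nu0.
rewrite proj dot_aniso.
have h t : `|t| <= e -> t ^+ 2 <= e ^+ 2.
  by move=> te; rewrite -real_normK ?num_real// lerXn2r ?nnegrE//;
    apply: le_trans te.
have {}h1 := h _ h1; have {}h2 := h _ h2.
pose t := dot c nu ^+ 2 / normsq nu.
have t0 : 0 <= t by rewrite divr_ge0 ?sqr_ge0 ?(ltW N0).
have tc : t <= normsq c.
  rewrite -subr_ge0 (_ : _ - t = normsq (aniso 0 1 nu *m c)) ?normsq_ge0//.
  by rewrite proj dot_aniso /t; ring.
have -> : e2 ^+ 2 * normsq c + (e1 ^+ 2 - e2 ^+ 2) / normsq nu * dot c nu ^+ 2 =
  e2 ^+ 2 * (normsq c - t) + e1 ^+ 2 * t by rewrite /t; ring.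
have -> : e ^+ 2 * normsq c = e ^+ 2 * (normsq c - t) + e ^+ 2 * t by ring.
by rewrite lerD// ler_wpM2r// subr_ge0.
Qed.

(** The difference of the two inverse operators is again of the form [aniso],
    with eigenvalues the differences of the inverses. *)
Lemma aniso_solve_close e l1 l2 k1 k2 nu x y c : nu != 0 ->
  l1 != 0 -> l2 != 0 -> k1 != 0 -> k2 != 0 ->
  `|l1^-1 - k1^-1| <= e -> `|l2^-1 - k2^-1| <= e ->
  aniso l1 l2 nu *m x = c -> aniso k1 k2 nu *m y = c ->
  normsq (x - y) <= e ^+ 2 * normsq c.
Proof.
move=> nu0 l10 l20 k10 k20 h1 h2 xc yc.
have solve t1 t2 z : t1 != 0 -> t2 != 0 -> aniso t1 t2 nu *m z = c ->
    z = aniso t1^-1 t2^-1 nu *m c.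
  by move=> t10 t20 <-; rewrite mulmxA anisoM// !mulVf// aniso_scalar mul1mx.
rewrite (solve _ _ _ l10 l20 xc) (solve _ _ _ k10 k20 yc) -mulmxBl anisoB.
exact: normsq_aniso_le.
Qed.

Lemma multiplier_aniso mu lams delta beta nu :
  multiplier mu lams delta beta nu =
  aniso (lambda1 mu lams delta beta nu) (lambda2 mu delta beta nu) nu.
Proof. by apply/esym/multiplier_unique; exact: is_multiplier_explicit. Qed.

Lemma navier_aniso (mu lams : R) (k : 'cV[int]_n) : realvec R k != 0 ->
  navier_multiplier mu lams k =
  aniso (- (lams + 2 * mu) * normsq (realvec R k))
        (- mu * normsq (realvec R k)) (realvec R k).
Proof.
move=> k0; rewrite /navier_multiplier /aniso addrC mulNr raddfN /=;
  congr (_ + _).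
rewrite -scaleNr; congr (_ *: _); field.
by rewrite normsq_eq0.
Qed.

Lemma cnormsq_ReIm (z : 'cV[R[i]]_n) :
  cnormsq z =
  normsq (map_mx (@complex.Re R) z) + normsq (map_mx (@complex.Im R) z).
Proof.
rewrite /cnormsq big_split /=; congr (_ + _);
  by apply: eq_bigr => i _; rewrite mxE expr2.
Qed.

Lemma cnormsq_ge0 (z : 'cV[R[i]]_n) : 0 <= cnormsq z.
Proof. by rewrite cnormsq_ReIm addr_ge0 ?normsq_ge0. Qed.

Lemma Re_mulmx (A : 'M[R]_n) (z : 'cV[R[i]]_n) :
  map_mx (@complex.Re R) (map_mx (real_complex R) A *m z) =
  A *m map_mx (@complex.Re R) z.
Proof.
apply/matrixP => i j; rewrite !mxE raddf_sum /=; apply: eq_bigr => l _.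
by rewrite !mxE; case: (z l j) => a b /=; rewrite mul0r subr0.
Qed.

Lemma Im_mulmx (A : 'M[R]_n) (z : 'cV[R[i]]_n) :
  map_mx (@complex.Im R) (map_mx (real_complex R) A *m z) =
  A *m map_mx (@complex.Im R) z.
Proof.
apply/matrixP => i j; rewrite !mxE raddf_sum /=; apply: eq_bigr => l _.
by rewrite !mxE; case: (z l j) => a b /=; rewrite mul0r addr0.
Qed.

(** A real matrix acts separately on real and imaginary parts. *)
Lemma complex_aniso_solve_close e l1 l2 k1 k2 nu (x y c : 'cV[R[i]]_n) :
  nu != 0 ->
  l1 != 0 -> l2 != 0 -> k1 != 0 -> k2 != 0 ->
  `|l1^-1 - k1^-1| <= e -> `|l2^-1 - k2^-1| <= e ->
  map_mx (real_complex R) (aniso l1 l2 nu) *m x = c ->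
  map_mx (real_complex R) (aniso k1 k2 nu) *m y = c ->
  cnormsq (x - y) <= e ^+ 2 * cnormsq c.
Proof.
move=> nu0 l10 l20 k10 k20 h1 h2 xc yc.
rewrite !cnormsq_ReIm mulrDr !map_mxB; apply: lerD.
- by apply: (aniso_solve_close nu0 l10 l20 k10 k20 h1 h2);
    rewrite -Re_mulmx ?xc ?yc.
- by apply: (aniso_solve_close nu0 l10 l20 k10 k20 h1 h2);
    rewrite -Im_mulmx ?xc ?yc.
Qed.

End Anisotropic.

(** * Sobolev norms *)
Section Sobolev.
Context {R : realType} {n : nat}.
Implicit Types (q s : R) (g h : vfourier R n) (k : 'cV[int]_n).

Lemma realvec_neq0 k : k != 0 -> realvec R k != 0.
Proof.
apply: contraNneq => /matrixP k0; apply/eqP/matrixP => i j.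
by have := k0 i j; rewrite !mxE => /eqP; rewrite intr_eq0 => /eqP.
Qed.

(** A positive sum of squares of integers is at least 1. *)
Lemma normsq_realvec_ge1 k : k != 0 -> 1 <= normsq (realvec R k).
Proof.
move=> /realvec_neq0/normsq_gt0.
have -> : normsq (realvec R k) = (normsq k)%:~R.
  rewrite /normsq /dot rmorph_sum /=; apply: eq_bigr => i _.
  by rewrite !mxE rmorphM.
by rewrite ltr0z ler1z.
Qed.

Lemma sobolev_weight_ge1 k : 1 <= 1 + normsq (realvec R k).
Proof. by rewrite lerDl normsq_ge0. Qed.

Lemma Hnormsq_ge0 q g : (0 <= Hnormsq q g)%E.
Proof.
by apply: esum_ge0 => k _; rewrite lee_fin mulr_ge0 ?powR_ge0 ?cnormsq_ge0.
Qed.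

Lemma Hnormsq_le (K : R) q s g h : 0 <= K ->
  (forall k, (1 + normsq (realvec R k)) `^ q * cnormsq (g k) <=
             K * ((1 + normsq (realvec R k)) `^ s * cnormsq (h k))) ->
  (Hnormsq q g <= K%:E * Hnormsq s h)%E.
Proof.
move=> K0 gh; apply: ge_ereal_sup => _ [X XT <-].
apply: (@le_trans _ _ (K%:E * \sum_(k \in X)
    ((1 + normsq (realvec R k)) `^ s * cnormsq (h k))%:E)%E).
  rewrite ge0_mule_fsumr; last first.
    by move=> k; rewrite lee_fin mulr_ge0 ?powR_ge0 ?cnormsq_ge0.
  by apply: lee_fsum => [|k _]; [case: XT | rewrite -EFinM lee_fin].
apply: lee_wpmul2l; first by rewrite lee_fin.
by apply: ereal_sup_ubound; exists X.
Qed.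

Lemma Hspace_mono q s g : q <= s -> Hspace n s g -> Hspace n q g.
Proof.
move=> qs; apply: le_lt_trans.
rewrite -[leRHS]mul1e; apply: Hnormsq_le => // k.
rewrite mul1r ler_wpM2r ?cnormsq_ge0//; apply: ler_powR => //.
exact: sobolev_weight_ge1.
Qed.

End Sobolev.

(** * Linear rate of convergence *)
Section Rate.
Context {R : realType} {n : nat}.

(** As N >= 1, (1 + N)^(eps / 2) / N is at most 2 (1 + N)^(eps / 2 - 1), and the
    square of this power is the quotient of the two Sobolev weights. *)
Lemma sobolev_absorb (eps q C N x : R) : 0 <= C -> 1 <= N -> 0 <= x ->
  (1 + N) `^ (q + 2 - eps) * ((C * ((1 + N) `^ (eps / 2) / N)) ^+ 2 * x) <=
  (2 * C) ^+ 2 * ((1 + N) `^ q * x).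
Proof.
move=> C0 N1 x0; set Y := 1 + N.
have Y0 : 0 < Y by rewrite /Y; lra.
have N0 : 0 < N by lra.
have -> : Y `^ (q + 2 - eps) = Y `^ q * Y ^+ 2 / (Y `^ (eps / 2)) ^+ 2.
  rewrite -!powR_mulrn ?powR_ge0 ?(ltW Y0)// -powRrM -powRN -!powRD
    ?(gt_eqF Y0) ?implybT//.
  by congr (_ `^ _); field.
have Z0 : 0 < Y `^ (eps / 2) by rewrite powR_gt0.
have -> : Y `^ q * Y ^+ 2 / Y `^ (eps / 2) ^+ 2 *
    ((C * (Y `^ (eps / 2) / N)) ^+ 2 * x) = (C * (Y / N)) ^+ 2 * (Y `^ q * x).
  by field; rewrite !gt_eqF.
rewrite ler_wpM2r ?mulr_ge0 ?powR_ge0//.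
rewrite lerXn2r ?nnegrE ?mulr_ge0 ?invr_ge0 ?(ltW Y0) ?(ltW N0)//.
by rewrite [leRHS]mulrC ler_wpM2l// ler_pdivrMr// /Y; lra.
Qed.

(** Frequency by frequency, v - w is the difference of the inverse multipliers
    applied to b.  Taking theta = eps / 4 in the eigenvalue bounds produces the
    power eps / 2 that [sobolev_absorb] accounts for. *)
Lemma Hnormsq_solution_le (mu lams delta eps s : R) : (1 <= n)%N ->
  0 < mu -> 0 < lams + 2 * mu -> 0 < eps ->
  exists K a0 : R, [/\ 0 <= K, 0 < a0 & forall (beta : R),
    let a := (n%:R + 2 - beta) / 2 in 0 < a <= a0 ->
    (forall nu : 'cV[R]_n, nu != 0 -> lambda1 mu lams delta beta nu != 0) ->
    (forall nu : 'cV[R]_n, nu != 0 -> lambda2 mu delta beta nu != 0) ->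
    forall b v w : vfourier R n, v 0 = 0 -> w 0 = 0 ->
    peridynamic mu lams delta beta v = b -> navier mu lams w = b ->
    (Hnormsq (s + 2 - eps)%R (fun k => (v k - w k)%R) <=
     ((K * a) ^+ 2)%:E * Hnormsq s b)%E].
Proof.
move=> n1 mu0 L0 eps0.
have th0 : 0 < eps / 4 by lra.
have [E1 [a1 [E10 a10 h1]]] := lambda1_inv_close delta n1 mu0 L0 th0.
have [E2 [a2 [E20 a20 h2]]] := lambda2_inv_close delta n1 mu0 th0.
exists (2 * (E1 + E2)), (Num.min a1 a2); split.
- by rewrite mulr_ge0 ?addr_ge0.
- by rewrite lt_min a10.
move=> beta a /andP[a0]; rewrite le_min => /andP[aa1 aa2] l1 l2 b v w v0 w0 vb
  wb.
apply: Hnormsq_le => [|k]; first exact: sqr_ge0.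
have [->|k0] := eqVneq k 0.
  rewrite v0 w0 subrr [cnormsq 0](_ : _ = 0) ?mulr0.
    exact: mulr_ge0 (sqr_ge0 _) (mulr_ge0 (powR_ge0 _ _) (cnormsq_ge0 _)).
  by rewrite /cnormsq big1// => i _; rewrite mxE /= expr0n addr0.
have nu0 := @realvec_neq0 R _ _ k0; have N1 := @normsq_realvec_ge1 R _ _ k0.
set nu := realvec R k in nu0 N1 *; set N := normsq nu in N1 *.
have e0 : 0 <= a * ((1 + N) `^ (eps / 2) / N).
  have N0 : 0 <= N by lra.
  exact: mulr_ge0 (ltW a0) (divr_ge0 (powR_ge0 _ _) N0).
have th2 : 2 * (eps / 4) = eps / 2 by field.
have hvw : cnormsq (v k - w k) <=
    ((E1 + E2) * a * ((1 + N) `^ (eps / 2) / N)) ^+ 2 * cnormsq (b k).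
  have N0 : 0 < N by lra.
  apply: (complex_aniso_solve_close nu0 (l1 _ nu0) (l2 _ nu0)
      (k1 := - (lams + 2 * mu) * N) (k2 := - mu * N)).
  - by rewrite mulf_neq0 ?oppr_eq0 ?gt_eqF.
  - by rewrite mulf_neq0 ?oppr_eq0 ?gt_eqF.
  - have := h1 beta nu; rewrite -/a a0 aa1 => /(_ isT nu0)/le_trans; apply.
    by rewrite th2 -/N -2!mulrA ler_wpM2r// lerDl.
  - have := h2 beta nu; rewrite -/a a0 aa2 => /(_ isT nu0)/le_trans; apply.
    by rewrite th2 -/N -2!mulrA ler_wpM2r// lerDr.
  - by rewrite -multiplier_aniso -vb.
  - by rewrite -navier_aniso// -wb navierE.
apply: le_trans (_ : _ <= (1 + N) `^ (s + 2 - eps) *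
  (((E1 + E2) * a * ((1 + N) `^ (eps / 2) / N)) ^+ 2 * cnormsq (b k))) _.
  by rewrite ler_wpM2l ?powR_ge0.
rewrite -[2 * _ * a]mulrA; apply: sobolev_absorb => //.
  by rewrite mulr_ge0 ?addr_ge0 ?(ltW a0).
exact: cnormsq_ge0.
Qed.

End Rate.

Theorem theorem15 (R : realType) (n : nat) (hn : (1 <= n)%N)
    (mu lams : R) (hmu : 0 < mu) (hlm : 0 < lams + 2 * mu)
    (delta : R) (hdelta : 0 < delta)
    (hlambda1 : forall (beta : R) (nu : 'cV[R]_n),
       beta < n%:R + 2 -> nu != 0 -> lambda1 mu lams delta beta nu < 0)
    (hlambda2 : forall (beta : R) (nu : 'cV[R]_n),
       beta < n%:R + 2 -> nu != 0 -> lambda2 mu delta beta nu < 0)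
    (s : R) (b : vfourier R n) (hb : Hspace n s b) (hb0 : b 0 = 0)
    (uN : vfourier R n) (huN : Hspace n (s + 2) uN)
    (huN_eq : navier mu lams uN = b) (huN0 : uN 0 = 0)
    (u : R -> vfourier R n)
    (hu : forall beta : R, beta < n%:R + 2 ->
       Hspace n (s + Num.max 0 (beta - n%:R)) (u beta))
    (hu_eq : forall beta : R, beta < n%:R + 2 ->
       peridynamic mu lams delta beta (u beta) = b)
    (hu0 : forall beta : R, beta < n%:R + 2 -> u beta 0 = 0)
    (eps : R) (heps0 : 0 < eps) (heps2 : eps < 2) :
  Hcvg (s + 2 - eps) (at_left (n%:R + 2)) u uN.
Proof.
have [K [a0 [K0 a00 rate]]] := @Hnormsq_solution_le R n mu lams delta eps s hn
  hmu hlm heps0.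
split.
- by apply: Hspace_mono huN; lra.
- near=> t.
  have t2 : t < n%:R + 2 by near: t; exact: nbhs_left_lt.
  apply: Hspace_mono (hu _ t2).
  have te : n%:R + 2 - eps <= t.
    by near: t; apply: nbhs_left_ge; lra.
  have : t - n%:R <= Num.max 0 (t - n%:R) by rewrite le_max lexx orbT.
  by lra.
have [B B0 hB] : exists2 B : R, 0 <= B & Hnormsq s b = (B ^+ 2)%:E.
  have := Hnormsq_ge0 s b; move: hb; rewrite /Hspace /=.
  case: (Hnormsq s b) => // r _; rewrite lee_fin => r0.
  by exists (Num.sqrt r); rewrite ?sqrtr_ge0// sqr_sqrtr.
pose h (t : R) : R := K * ((n%:R + 2 - t) / 2) * B.
apply: (@squeeze_cvge _ _ _ _ (cst 0%E) _ (EFin \o h)); last 2 first.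
- exact: cvg_cst.
- apply: cvg_EFin; first by near=> t.
  apply: cvg_at_left_filter; rewrite [X in _ --> X](_ : _ = h (n%:R + 2));
    last first.
    by rewrite /h subrr mul0r mulr0 mul0r.
  apply: cvgM; last exact: cvg_cst.
  apply: cvgM; first exact: cvg_cst.
  apply: cvgM; last exact: cvg_cst.
  by apply: cvgB; [exact: cvg_cst | exact: cvg_id].
near=> t.
have t2 : t < n%:R + 2 by near: t; exact: nbhs_left_lt.
have ta : n%:R + 2 - 2 * a0 <= t.
  by near: t; apply: nbhs_left_ge; lra.
have h0 : 0 <= h t by rewrite !mulr_ge0//; lra.
rewrite sqrte_ge0 /=.
have -> : (h t)%:E = sqrte ((h t ^+ 2)%:E) by rewrite /= sqrtr_sqr ger0_norm.
rewrite lee_sqrt ?lee_fin ?sqr_ge0// /h exprMn EFinM -hB.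
apply: rate => //.
- by apply/andP; split; lra.
- by move=> nu nu0; rewrite lt_eqF// hlambda1.
- by move=> nu nu0; rewrite lt_eqF// hlambda2.
- exact: hu0.
- exact: hu_eq.
Unshelve. all: by end_near. Qed.
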